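(* For every finite (nonempty) region $R\subset\mathbb{R}^2$ and every integer $n\ge 2$, the per-tile entropy of the $n$-ribbon tilings of $R$ satisfies $$\mathrm{Ent}_n(R)\le \log_2 n .$$
   Context: A unit square means a set $[x,x+1]\times[y,y+1]$ with $(x,y)\in\mathbb{Z}^2$. A region $R$ is a union of a finite number of unit squares (it need not be connected or simply connected). Its area $A(R)$ is the number of unit squares it contains. A ribbon tile of length $n$ (an $n$-ribbon) is a connected sequence of $n$ unit squares, each of which (except the first one) comes directly above or directly to the right of its predecessor; that is, if the predecessor is $[x,x+1]\times[y,y+1]$, then the next square is $[x,x+1]\times[y+1,y+2]$ or $[x+1,x+2]\times[y,y+1]$. An $n$-ribbon tiling of $R$ is a set of $n$-ribbons, each consisting of unit squares of $R$, such that every unit square of $R$ belongs to exactly one ribbon of the set. Let $\mathcal{T}_n(R)$ be the number of $n$-ribbon tilings of $R$. The per-tile entropy of the $n$-ribbon tilings of $R$ is $$\mathrm{Ent}_n(R)=\frac{\log_2(\mathcal{T}_n(R))}{A(R)/n},$$ with the convention $\log_2 0=-\infty$ when $R$ has no $n$-ribbon tiling. *)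

(* Defs.v *)
From mathcomp Require Import all_boot all_order all_algebra finmap.
From mathcomp Require Import all_classical all_reals all_analysis.

Set Implicit Arguments.
Unset Strict Implicit.
Unset Printing Implicit Defensive.

Import Order.TTheory GRing.Theory Num.Theory.

Local Open Scope ring_scope.

(* The unit square [x, x+1] x [y, y+1] is represented by its corner (x, y). *)
Definition square : Type := (int * int)%type.

(* A finite union of unit squares, represented by the set of the squares it
   contains; this set determines the union and is determined by it. *)
Definition region : Type := {fset square}.

Definition area (D : region) : nat := #|` D|.

Definition step (p q : square) : bool :=
  (q == (p.1, p.2 + 1)) || (q == (p.1 + 1, p.2)).

Definition ribbon (n : nat) (s : seq square) : bool :=
  (size s == n) && sorted step s.

(* The elements of [n.-tuple D] are the sequences of [n] squares of [D].  A
   ribbon is the increasing enumeration (for x + y) of its underlying set of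
   squares, so sets of sequences count the same tilings as sets of subsets. *)
Definition ribbon_tiling (n : nat) (D : region) (T : {set n.-tuple D}) : bool :=
  [forall t in T, ribbon n [seq \val x | x <- t]] &&
  [forall x : D, #|[set t in T | x \in t]| == 1%N].

Definition num_tilings (n : nat) (D : region) : nat :=
  #|[set T : {set n.-tuple D} | ribbon_tiling T]|.

(* [lne 0 = -oo], hence [log2 0 = -oo]. *)
Definition log2 (R : realType) (x : \bar R) : \bar R :=
  (lne x / (ln 2)%:E)%E.

Definition entropy (R : realType) (n : nat) (D : region) : \bar R :=
  (log2 (num_tilings n D)%:R%:E / ((area D)%:R / n%:R)%:E)%E.

(* Main.v *)
Require Import Defs.
From mathcomp Require Import all_boot all_order all_algebra finmap.
From mathcomp Require Import all_classical all_reals all_analysis.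
From mathcomp Require Import zify.

(** A region with a tiling has area [n * N], where [N] is the number of tiles,
    so the claim is that there are at most [n ^ N] tilings.

    Call [x + y] the level of the square at [(x, y)]; a tile has one square on
    each of [n] consecutive levels.  Reveal a tiling level by level.  Once the
    levels below [l] are known, so is the set [C] of the squares of level
    [l - 1] that are not the last of their tile.  A square of [C] with abscissa
    [x] continues to one of the squares of level [l] with abscissa [x] or
    [x + 1].  View it as an edge joining these two, one of which may be missing
    from the region: the level becomes a disjoint union of paths, each edge has
    to choose one of its ends, no square being chosen twice, and the squares
    which are not chosen start new tiles.  A path with as many squares as edges
    has no start.  A path with one square more has exactly one start, which can
    be any of its squares, and whose position decides where all the edges of the
    path go: they point away from it.  Hence the number of ways to continue is
    at most the product of the cardinals of the paths that contain a start
    ([card_unmatched_family]), and the set of starts determines the continuation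
    ([unmatched_determines]).

    This exhibits the tilings as the leaves of a tree.  If the product of the
    degrees along every branch is at most [M], the tree has at most [M] leaves
    ([leq_card_branching]).  Along the branch of a given tiling the product is
    at most that of the cardinals of the paths of all its [N] starts.  These
    paths are pairwise disjoint, so the cardinals add up to at most [n * N], and
    by the inequality of arithmetic and geometric means their product is at most
    [n ^ N] ([prod_run]). *)

Set Implicit Arguments.
Unset Strict Implicit.
Unset Printing Implicit Defensive.

Import Order.TTheory GRing.Theory Num.Theory.

(** * Counting the leaves of a tree *)

Section Branching.
Variables (X Y : finType) (I : eqType) (key : I -> X -> Y).

(** The elements of [A] are the leaves of a tree that branches on the values of
    the successive keys; this is the product of the degrees of the nodes on the
    way from the root to the leaf [x]. *)
Fixpoint branching (A : {set X}) (ls : seq I) (x : X) : nat :=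
  if ls is l :: ls' then
    #|key l @: A| * branching [set y in A | key l y == key l x] ls' x
  else 1.

(** A leaf chosen by a uniform choice at each node is [x] with probability at
    least [1 / M], and these probabilities add up to 1.  The induction uses the
    equivalent statement on subtrees: below a root of degree [k] the bound
    becomes [M %/ k]. *)
Lemma leq_card_branching (ls : seq I) (A : {set X}) (M : nat) :
    {in A &, forall x y, {in ls, forall l, key l x = key l y} -> x = y} ->
    (forall x, x \in A -> branching A ls x <= M) ->
  #|A| <= M.
Proof.
elim: ls A M => [|l ls IHls] A M keyA leM /=.
  have [->|[x Ax]] := set_0Vmem A; first by rewrite cards0.
  have -> : A = [set x].
    apply/setP=> y; rewrite inE; apply/idP/eqP=> [Ay|->//].
    by apply: keyA => // l; rewrite in_nil.
  by rewrite cards1; exact: leM Ax.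
rewrite -sum1_card (partition_big_imset (key l)) /=.
have [A0|[x0 Ax0]] := set_0Vmem A.
  by rewrite A0 imset0 big_set0.
set K := key l @: A.
have K_gt0 : 0 < #|K| by apply/card_gt0P; exists (key l x0); exact: imset_f.
have fiber c : c \in K -> \sum_(x in A | key l x == c) 1 <= M %/ #|K|.
  case/imsetP=> x Ax ->; rewrite sum1dep_card.
  apply: IHls => [y z|y].
    rewrite !inE => /andP[Ay /eqP yx] /andP[Az /eqP zx] keyyz.
    apply: keyA => // l'; rewrite inE => /orP[/eqP->|]; last exact: keyyz.
    by rewrite yx zx.
  rewrite inE => /andP[Ay /eqP yx]; rewrite leq_divRL // mulnC -yx.
  exact: leM Ay.
apply: (@leq_trans (\sum_(c in K) M %/ #|K|)); first exact: leq_sum.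
by rewrite sum_nat_const mulnC leq_trunc_div.
Qed.

End Branching.

Lemma leq_prod_AGM (I : finType) (A : {set I}) (E : I -> nat) (c : nat) :
  \sum_(i in A) E i <= c * #|A| -> \prod_(i in A) E i <= c ^ #|A|.
Proof.
move=> sumE; rewrite -(ler_nat rat).
have [A0|A_gt0] := posnP #|A|.
  by have /eqP := A0; rewrite cards_eq0 => /eqP ->; rewrite big_set0 cards0.
have [|le_mean _] := @leif_AGM rat _ (mem A) (fun i => (E i)%:R)%R.
  by move=> i _; exact: ler0n.
rewrite natr_prod natrX; apply: le_trans le_mean _.
apply: lerXn2r; rewrite ?nnegrE ?divr_ge0 ?sumr_ge0 ?ler0n //.
by rewrite ler_pdivrMr ?ltr0n // -natr_sum -natrM ler_nat.
Qed.

(** * Matching the edges of paths to their ends *)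

(** The vertices of the paths are the elements of [S].  The element [u] of [C] is
    the edge between the vertices of position [pos u] and [pos u + 1]; as one of
    the two may be missing from [S], edges can have a single end. *)
Section PathMatchings.
Local Open Scope ring_scope.
Variables (V : finType) (pos : V -> int) (S C : {set V}).
Hypotheses (posS : {in S &, injective pos}) (posC : {in C &, injective pos}).

Definition touches (u z : V) : bool :=
  (z \in S) && ((pos z == pos u) || (pos z == pos u + 1)).

Definition matching (f : V -> V) : Prop :=
  {in C, forall u, touches u (f u)} /\ {in C &, injective f}.

Definition unmatched (f : V -> V) : {set V} := S :\: f @: C.

Definition adj : rel V :=
  fun z z' => [exists u in C, touches u z && touches u z'].

Definition component (z : V) : {set V} := [set z' | connect adj z z'].

Lemma connect_adj_sym : connect_sym adj.
Proof.
apply: sym_connect_sym => z z'; apply: eq_existsb => u.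
by congr (_ && _); rewrite andbC.
Qed.

Lemma component_sub z : z \in S -> component z \subset S.
Proof.
move=> Sz; apply/fintype.subsetP=> z'; rewrite inE => /connectP[p].
elim: p z Sz => [|y p IHp] z Sz /= => [_ ->//|/andP[/existsP[u]]].
by case/and3P=> _ _ /andP[Sy _] /IHp; apply.
Qed.

(** The target of an edge is linked by this edge to any other end of it. *)
Lemma component_matching f z u : matching f -> u \in C ->
  (f u \in component z) = [exists z' in component z, touches u z'].
Proof.
move=> [fC _] Cu; apply/idP/existsP => [zfu|[z' /andP[zz' uz']]].
  by exists (f u); rewrite zfu fC.
move: zz'; rewrite !inE => zz'; apply: connect_trans zz' (connect1 _).
by apply/existsP; exists u; rewrite Cu uz' fC.
Qed.

(** A matching sends the edges that touch a component injectively into this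
    component, and no other edge goes there.  So the number of unmatched vertices
    of a component does not depend on the matching. *)
Lemma card_component_unmatched f z : matching f -> z \in S ->
  #|component z :&: unmatched f| =
  (#|component z| -
   #|[set u in C | [exists z' in component z, touches u z']]|)%N.
Proof.
move=> mf Sz; set E := [set u in C | _].
have -> : component z :&: unmatched f = component z :\: (f @: E).
  apply/setP=> y; rewrite !inE.
  case: (boolP (connect adj z y)) => //= zy; last by rewrite andbF.
  have Sy : y \in S by apply: (fintype.subsetP (component_sub Sz)); rewrite inE.
  rewrite Sy !andbT; congr (~~ _); apply/imsetP/imsetP=> -[u].
    move=> Cu yfu; exists u => //; rewrite inE Cu -(component_matching _ mf) //.
    by rewrite -yfu inE.
  by rewrite inE => /andP[Cu _] ->; exists u.
rewrite cardsD; congr (_ - _)%N.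
rewrite (finset.setIidPr _).
  rewrite card_in_imset // => u v; rewrite !inE => /andP[Cu _] /andP[Cv _].
  exact: mf.2.
apply/fintype.subsetP=> _ /imsetP[u + ->]; rewrite inE => /andP[Cu Eu].
by rewrite component_matching.
Qed.

Lemma unmatched_neq f s u : u \in C -> s \in unmatched f -> f u != s.
Proof.
move=> Cu; rewrite inE => /andP[sf _].
by apply: contraNneq sf => <-; exact: imset_f.
Qed.

(** A component has at most one unmatched vertex [s]: the edges next to [s] must
    point away from it, which fills their other ends, so the next edges point
    away from [s] too, and so on to both ends of the component. *)
Lemma unmatched_connect_eq f s z :
  matching f -> s \in unmatched f -> z \in unmatched f ->
  connect adj s z -> s = z.
Proof.
move=> [fC finj] s_un z_un.
have Ss : s \in S by move: s_un; rewrite inE => /andP[].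
have Sz : z \in S by move: z_un; rewrite inE => /andP[].
(* All the positions between s and y carry an edge pointing away from s. *)
pose away y :=
  (forall k, pos s <= k < pos y ->
     exists2 u, u \in C & pos u = k /\ pos (f u) = k + 1) /\
  (forall k, pos y <= k < pos s ->
     exists2 u, u \in C & pos u = k /\ pos (f u) = k).
have away_step y y' : y \in S -> away y -> adj y y' -> away y'.
  move=> Sy [yR yL] /existsP[u /and3P[Cu /andP[_ uy] /andP[Sy' uy']]].
  have /andP[Sfu ufu] := fC _ Cu.
  case/orP: uy => /eqP uy; case/orP: uy' => /eqP uy'.
  - by rewrite /away uy' -uy.
  - have [fuy|fuy] := eqVneq (f u) y.
      have [sy|sy|sy] := ltgtP (pos s) (pos y).
      + have [|v Cv [vk fvk]] := yR (pos y - 1); first lia.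
        have fvy : f v = y by apply: posS => //; [have /andP[] := fC _ Cv | lia].
        by have vu := finj _ _ Cv Cu (etrans fvy (esym fuy)); subst v; lia.
      + split=> k kb; first lia.
        by apply: yL; lia.
      + have := unmatched_neq Cu s_un; rewrite fuy => /eqP[].
        by apply: posS.
    have fu1 : pos (f u) = pos u + 1.
      case/orP: ufu => /eqP // fu0; case/eqP: fuy; apply: posS => //; lia.
    split=> k kb; last by apply: yL; lia.
    have [ky|ky] := ltP k (pos y); first by apply: yR; lia.
    by exists u => //; split; lia.
  - have [fuy|fuy] := eqVneq (f u) y.
      have [sy|sy|sy] := ltgtP (pos s) (pos y).
      + split=> k kb; last lia.
        by apply: yR; lia.
      + have [|v Cv [vk fvk]] := yL (pos y); first lia.
        have fvy : f v = y by apply: posS => //; have /andP[] := fC _ Cv.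
        by have vu := finj _ _ Cv Cu (etrans fvy (esym fuy)); subst v; lia.
      + have := unmatched_neq Cu s_un; rewrite fuy => /eqP[].
        by apply: posS.
    have fu1 : pos (f u) = pos u.
      case/orP: ufu => /eqP // fu0; case/eqP: fuy; apply: posS => //; lia.
    split=> k kb; first by apply: yR; lia.
    have [ky|ky] := leP (pos y) k; first by apply: yL; lia.
    by exists u => //; split; lia.
  - by rewrite /away uy' -uy.
have away_connect y : connect adj s y -> away y.
  have away_path p y0 :
      y0 \in S -> away y0 -> path adj y0 p -> away (last y0 p).
    elim: p y0 => [|y1 p IHp] y0 Sy0 away0 //= /andP[e01 pth].
    apply: IHp => //; last exact: away_step e01.
    by case/existsP: e01 => u /and3P[_ _ /andP[]].
  case/connectP=> p pth ->; apply: away_path => //.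
  by split=> k /andP[k1 k2]; move: (le_lt_trans k1 k2); rewrite ltxx.
move=> /away_connect[zR zL]; have [sz|zs|/posS->//] := ltgtP (pos s) (pos z).
- have [|u Cu [uk fuk]] := zR (pos z - 1); first lia.
  have /andP[Sfu _] := fC _ Cu.
  by have /eqP[] := unmatched_neq Cu z_un; apply: posS => //; lia.
- have [|u Cu [uk fuk]] := zL (pos z); first lia.
  have /andP[Sfu _] := fC _ Cu.
  by have /eqP[] := unmatched_neq Cu z_un; apply: posS.
Qed.

(** If [f] sends the edge [u] left and [g] sends it right, then [g u] is matched
    by [f], necessarily with the next edge, which [f] sends left and [g] right;
    this would go on forever. *)
Lemma unmatched_determines f g :
  matching f -> matching g -> unmatched f = unmatched g -> {in C, f =1 g}.
Proof.
wlog: f g / exists2 u, u \in C & pos (f u) = pos u /\ pos (g u) = pos u + 1.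
  move=> IH mf mg fg u Cu; apply/eqP; apply: contraT => /eqP fgu.
  have /andP[Sfu ufu] := mf.1 _ Cu; have /andP[Sgu ugu] := mg.1 _ Cu.
  have nposfg : pos (f u) <> pos (g u) by move/posS => /(_ Sfu Sgu).
  case/orP: ufu => /eqP ufu; case/orP: ugu => /eqP ugu; try lia.
    by case: fgu; apply: IH => //; exists u.
  by case: fgu; apply/esym/IH => //; exists u.
case=> u0 Cu0 u0P mf mg fg; exfalso.
pose P u := [&& u \in C, pos (f u) == pos u & pos (g u) == pos u + 1].
have Pu0 : P u0 by rewrite /P Cu0 u0P.1 u0P.2 !eqxx.
have [u /and3P[Cu /eqP fu /eqP gu] umax] := Order.TotalTheory.arg_maxP pos Pu0.
have /andP[Sgu _] := mg.1 _ Cu.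
have : g u \notin unmatched f by rewrite fg inE imset_f.
rewrite inE Sgu andbT negbK => /imsetP[v Cv guv].
have /andP[_ vfv] := mf.1 _ Cv.
have vu : v <> u.
  by move=> vu; move: guv; rewrite vu => guv; move: gu; rewrite guv; lia.
have pv : pos v = pos u + 1.
  case/orP: vfv => /eqP vfv; first by rewrite -vfv -guv.
  by case: vu; apply: posC => //; move: vfv; rewrite -guv gu; lia.
have /andP[Sgv vgv] := mg.1 _ Cv.
have gv : pos (g v) = pos v + 1.
  case/orP: vgv => /eqP // vgv; case: vu; apply: mg.2 => //.
  by apply: posS => //; rewrite vgv pv gu.
have : pos v <= pos u.
  by apply: umax; rewrite /P Cv gv -guv gu pv !eqxx.
by rewrite pv; lia.
Qed.

(** The sets of unmatched vertices of all matchings meet the same components,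
    each in one vertex: such a set is given by the choice of a vertex in the
    component of each element of [B0]. *)
Lemma card_unmatched_family (Bs : {set {set V}}) (B0 : {set V}) :
    {in Bs, forall B, exists2 f, matching f & B = unmatched f} -> B0 \in Bs ->
  (#|Bs| <= \prod_(s in B0) #|component s|)%N.
Proof.
move=> BsP B0Bs; have [f0 m0 B0E] := BsP _ B0Bs.
have subS B : B \in Bs -> {subset B <= S}.
  by move=> /BsP[f _ ->] z; rewrite inE => /andP[].
have meet B B' z z' : B \in Bs -> B' \in Bs -> z \in B -> connect adj z z' ->
    exists2 y, y \in B' & connect adj z' y.
  move=> BB BB' zB zz'; have Sz := subS _ BB _ zB.
  have [f mf fE] := BsP _ BB; have [f' mf' fE'] := BsP _ BB'.
  have : (0 < #|component z :&: B|)%N.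
    by apply/card_gt0P; exists z; rewrite !inE connect0.
  rewrite fE (card_component_unmatched mf Sz).
  rewrite -(card_component_unmatched mf' Sz) -fE'.
  case/card_gt0P=> y; rewrite !inE => /andP[zy yB']; exists y => //.
  by apply: connect_trans zy; rewrite connect_adj_sym.
pose choice B : {ffun V -> V} :=
  [ffun s => if s \in B0 then odflt s [pick z in component s :&: B] else s].
have choiceP B s : B \in Bs -> s \in B0 -> choice B s \in component s :&: B.
  move=> BB sB0; rewrite ffunE sB0; case: pickP => [z|] //=.
  have [y yB sy] := meet _ _ _ _ B0Bs BB sB0 (connect0 _ s).
  by move=> /(_ y); rewrite !inE yB sy.
have choiceE B : B \in Bs -> B = choice B @: B0.
  move=> BB; apply/setP=> z; apply/idP/imsetP=> [zB|[s sB0 ->]]; last first.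
    by have := choiceP _ _ BB sB0; rewrite inE => /andP[].
  have [s sB0 zs] := meet _ _ _ _ BB B0Bs zB (connect0 _ z).
  exists s => //; have := choiceP _ _ BB sB0; rewrite !inE => /andP[sc cB].
  have [f mf fE] := BsP _ BB; apply: (unmatched_connect_eq mf); rewrite -?fE //.
  exact: connect_trans zs sc.
have choice_inj : {in Bs &, injective choice}.
  by move=> B B' BB BB' e; rewrite (choiceE _ BB) e -choiceE.
rewrite -(card_in_imset choice_inj).
(* Outside of B0 the choice functions are the identity. *)
pose F s := if s \in B0 then component s else [set s].
apply: (@leq_trans #|family F|).
  apply: subset_leq_card; apply/fintype.subsetP=> _ /imsetP[B BB ->].
  apply/familyP=> s; rewrite /F; case: ifP => sB0; last by rewrite ffunE sB0 inE.
  by have := choiceP _ _ BB sB0; rewrite inE => /andP[].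
rewrite card_family foldrE big_map big_enum /= [leqRHS]big_mkcond /=.
by rewrite leq_prod // => s _; rewrite /F; case: ifP; rewrite ?cards1.
Qed.

End PathMatchings.

(** * Ribbon tilings as prefix maps *)

Section PrefixMaps.
Local Open Scope nat_scope.
Variables (V : finType) (lev : V -> nat) (pos : V -> int) (n : nat).
Hypothesis lev_pos_inj : forall u v, lev u = lev v -> pos u = pos v -> u = v.

Definition precedes (u v : V) : bool :=
  (lev v == (lev u).+1) && ((pos v == pos u) || (pos v == pos u + 1)%R).

(** A tiling is encoded by the map that sends a square to the part of its tile
    that ends with this square.  The values on the levels up to [l] hold what a
    tiling shows on these levels, including how long each tile already is. *)
Record prefix_map (g : V -> seq V) : Prop := PrefixMap {
  prefix_size : forall x, size (g x) <= n;
  prefix_rcons : forall x,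
    g x = [:: x] \/ exists2 y, precedes y x & g x = rcons (g y) x;
  prefix_next : forall x, size (g x) < n -> exists! y, g y = rcons (g x) y }.

Definition diagonal (l : nat) : {set V} := [set x | lev x == l].

(** The edges of the paths on level [l]: the prefixes that are shorter than [n]
    are those of the squares that are not the last of their tile. *)
Definition links (g : V -> seq V) (l : nat) : {set V} :=
  [set x | ((lev x).+1 == l) && (size (g x) < n)].

Definition successor (g : V -> seq V) (x : V) : V :=
  odflt x [pick y | g y == rcons (g x) y].

Definition starts (g : V -> seq V) : {set V} := [set x | size (g x) == 1].

(** The path of squares on the level of [s] among which, given the lower levels,
    the start [s] could be placed. *)
Definition run (g : V -> seq V) (s : V) : {set V} :=
  component pos (diagonal (lev s)) (links g (lev s)) s.

Lemma diagonal_pos_inj l : {in diagonal l &, injective pos}.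
Proof.
move=> x y; rewrite !inE => /eqP lx /eqP ly.
by apply: lev_pos_inj; rewrite lx ly.
Qed.

Lemma links_pos_inj g l : {in links g l &, injective pos}.
Proof.
move=> x y; rewrite !inE => /andP[/eqP lx _] /andP[/eqP ly _].
by apply: lev_pos_inj; apply: succn_inj; rewrite lx ly.
Qed.

Section OneMap.
Variable g : V -> seq V.
Hypothesis gP : prefix_map g.

Lemma last_prefix y x : last y (g x) = x.
Proof. by case: (prefix_rcons gP x) => [->//|[z _ ->]]; rewrite last_rcons. Qed.

Lemma size_prefix_gt0 x : 0 < size (g x).
Proof. by case: (prefix_rcons gP x) => [->//|[z _ ->]]; rewrite size_rcons. Qed.

Lemma prefix_inj : injective g.
Proof. by move=> x y e; rewrite -(last_prefix x x) e last_prefix. Qed.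

Lemma successorP x : size (g x) < n ->
  g (successor g x) = rcons (g x) (successor g x) /\ precedes x (successor g x).
Proof.
move=> /(prefix_next gP)[y [gy _]].
have gn : g (successor g x) = rcons (g x) (successor g x).
  by rewrite /successor; case: pickP => [z /eqP //|/(_ y)]; rewrite gy eqxx.
split=> //; case: (prefix_rcons gP (successor g x)) => [e|[z zn]].
  have := congr1 size e; rewrite gn size_rcons => -[/eqP].
  by rewrite gtn_eqF ?size_prefix_gt0.
by rewrite gn => /rcons_inj[/prefix_inj xz]; rewrite -xz in zn.
Qed.

Lemma successor_unique x y :
  size (g x) < n -> g y = rcons (g x) y -> y = successor g x.
Proof.
move=> xn gy; have [z [_ zu]] := prefix_next gP xn.
by rewrite -(zu _ gy) -(zu _ (successorP xn).1).
Qed.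

Lemma successor_inj : {in [pred x | size (g x) < n] &, injective (successor g)}.
Proof.
move=> x y; rewrite !inE => /successorP[gx _] /successorP[gy _] e.
by move: gx; rewrite e gy => /rcons_inj[/prefix_inj].
Qed.

Lemma matching_successor l :
  matching pos (diagonal l) (links g l) (successor g).
Proof.
split=> [u|u v]; rewrite !inE.
  case/andP=> /eqP <- /successorP[_ /andP[/eqP lu pu]].
  by rewrite /touches inE lu eqxx.
by move=> /andP[_ un] /andP[_ vn]; apply: successor_inj.
Qed.

(** A prefix with at least two squares ends with the successor of its last but
    one square. *)
Lemma unmatched_successor l :
  unmatched (diagonal l) (links g l) (successor g) =
  [set s in starts g | lev s == l].
Proof.
apply/setP=> z; rewrite !inE andbC [RHS]andbC; case: (lev z =P l) => //= lz.
apply/idP/idP=> [|/eqP z1].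
  apply: contraNT => zn1; apply/imsetP.
  case: (prefix_rcons gP z) => [zE|[y yz zE]]; first by rewrite zE in zn1.
  have yn : size (g y) < n by have := prefix_size gP z; rewrite zE size_rcons.
  exists y; last exact: successor_unique.
  by rewrite inE yn andbT; case/andP: yz => /eqP<-; rewrite lz.
apply/imsetP=> -[u]; rewrite inE => /andP[_ /successorP[gu _] zu].
move: gu z1; rewrite -zu => ->; rewrite size_rcons => -[/eqP].
by rewrite gtn_eqF ?size_prefix_gt0.
Qed.

(** [successor] maps the squares of rank [k] in their tile bijectively to those
    of rank [k + 1], so that all ranks are equally frequent. *)
Lemma card_starts : 0 < n -> n * #|starts g| = #|V|.
Proof.
move=> n_gt0.
have layer k : k < n -> #|[set x | size (g x) == k.+1]| = #|starts g|.
  elim: k => // k IHk kn; rewrite -IHk; last exact: ltnW.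
  have inj : {in [set x | size (g x) == k.+1] &, injective (successor g)}.
    move=> x y; rewrite !inE => /eqP xk /eqP yk.
    by apply: successor_inj; rewrite inE ?xk ?yk.
  rewrite -(card_in_imset inj); apply: eq_card => z; rewrite inE.
  apply/eqP/imsetP=> [zk|[x]]; last first.
    rewrite inE => /eqP xk ->.
    have [|-> _] := @successorP x; first by rewrite xk.
    by rewrite size_rcons xk.
  case: (prefix_rcons gP z) => [zE|[y _ zE]]; first by rewrite zE in zk.
  move: (zk); rewrite zE size_rcons => -[yk].
  by exists y; [rewrite inE yk | apply: successor_unique; rewrite ?yk].
have lt x : (size (g x)).-1 < n.
  by rewrite prednK ?size_prefix_gt0 // prefix_size.
rewrite -[RHS]sum1_card (partition_big (fun x => Ordinal (lt x)) predT) //=.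
transitivity (\sum_(k < n) #|starts g|).
  by rewrite big_const_ord iter_addn_0 mulnC.
apply: eq_bigr => k _; rewrite -(layer k) // sum1dep_card.
apply: eq_card => x; rewrite !inE -val_eqE /=.
by case: (size (g x)) (size_prefix_gt0 x).
Qed.

(** A run contains no start but its own, so distinct runs are disjoint. *)
Lemma sum_run : \sum_(s in starts g) #|run g s| <= #|V|.
Proof.
under eq_bigr do rewrite -sum1_card.
rewrite (exchange_big_dep predT) //= -sum1_card; apply: leq_sum => z _.
rewrite sum1dep_card; apply/card_le1_eqP => s' s; rewrite !inE.
have lev_run t :
    connect (adj pos (diagonal (lev t)) (links g (lev t))) t z -> lev z = lev t.
  have St : t \in diagonal (lev t) by rewrite inE.
  move=> tz; have := fintype.subsetP (component_sub pos (links g (lev t)) St) z.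
  by rewrite !inE => /(_ tz)/eqP.
move=> /andP[s'1 s'z] /andP[s1 sz].
have ls : lev s' = lev s by rewrite -(lev_run _ sz) -(lev_run _ s'z).
rewrite ls in s'z.
apply: (unmatched_connect_eq (@diagonal_pos_inj (lev s))
                             (matching_successor (lev s))).
- by rewrite unmatched_successor !inE s1 eqxx.
- by rewrite unmatched_successor !inE s'1 ls eqxx.
- by apply: connect_trans sz _; rewrite connect_adj_sym.
Qed.

Lemma prod_run : 0 < n -> \prod_(s in starts g) #|run g s| <= n ^ #|starts g|.
Proof.
by move=> n_gt0; apply: leq_prod_AGM; rewrite card_starts //; exact: sum_run.
Qed.

End OneMap.

(** Tilings that agree below level [l] have the same edges towards level [l]; if
    they have the same starts there too, the edges are matched in the same
    way. *)
Lemma starts_agree g g' l : prefix_map g -> prefix_map g' ->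
    (forall x, lev x < l -> g x = g' x) ->
    [set s in starts g | lev s == l] = [set s in starts g' | lev s == l] ->
  forall x, lev x < l.+1 -> g x = g' x.
Proof.
move=> gP gP' agree startsE x; rewrite ltnS leq_eqVlt.
case/orP=> [/eqP lx|]; last exact: agree.
have linksE : links g' l = links g l.
  apply/setP=> u; rewrite !inE; case: (_ =P l) => //= lu.
  by rewrite agree // -lu.
have m := matching_successor gP l; have m' := matching_successor gP' l.
have fE := unmatched_successor gP l; have fE' := unmatched_successor gP' l.
rewrite linksE in m' fE'; rewrite -startsE -fE in fE'.
have succE :=
  unmatched_determines (@diagonal_pos_inj l) (@links_pos_inj g l) m' m fE'.
case: (boolP (x \in [set s in starts g | lev s == l])) => [xs|xns].
  have xs' := xs; rewrite startsE in xs'.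
  move: xs xs'; rewrite !inE => /andP[x1 _] /andP[x1' _].
  have single h : prefix_map h -> size (h x) == 1 -> h x = [:: x].
    move=> hP; case: (prefix_rcons hP x) => // -[y _ ->].
    by rewrite size_rcons eqSS gtn_eqF ?size_prefix_gt0.
  by rewrite (single g gP x1) (single g' gP' x1').
move: xns; rewrite -fE inE inE lx eqxx andbT negbK => /imsetP[u Cu xu].
move: (Cu); rewrite inE => /andP[/eqP lu un].
have [gx _] := successorP gP un.
have un' : size (g' u) < n by rewrite -agree // -lu.
have [gx' _] := successorP gP' un'.
by rewrite succE // in gx'; rewrite xu gx gx' agree // -lu.
Qed.

Section Counting.
Variables (X : finType) (A : {set X}) (g : X -> V -> seq V).
Hypothesis gP : {in A, forall T, prefix_map (g T)}.
Hypothesis g_inj : {in A &, forall T T', g T =1 g T' -> T = T'}.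

Definition new_starts (l : nat) (T : X) : {set V} :=
  [set s in starts (g T) | lev s == l].

(** The degree of a node at level [l] counts the possible sets of starts on this
    level, for the tilings that agree below. *)
Lemma branching_runs k l (A' : {set X}) T :
    A' \subset A -> T \in A' ->
    {in A', forall T' x, lev x < l -> g T' x = g T x} ->
  branching new_starts A' (iota l k) T <=
  \prod_(j <- iota l k) \prod_(s in new_starts j T) #|run (g T) s|.
Proof.
elim: k l A' => [|k IHk] l A' sA' A'T agree; first by rewrite big_nil.
have gA' T' : T' \in A' -> prefix_map (g T').
  by move=> /(fintype.subsetP sA')/gP.
rewrite big_cons /=; apply: leq_mul; last first.
  apply: IHk.
  - apply: fintype.subset_trans sA'.
    by apply/fintype.subsetP=> T'; rewrite inE => /andP[].
  - by rewrite inE A'T eqxx.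
  move=> T'; rewrite inE => /andP[A'T' /eqP startsE].
  apply: starts_agree; [exact: gA' | exact: gA' | exact: agree |].
  exact: startsE.
have -> : \prod_(s in new_starts l T) #|run (g T) s| =
    \prod_(s in new_starts l T) #|component pos (diagonal l) (links (g T) l) s|.
  by apply: eq_bigr => s; rewrite inE => /andP[_ /eqP ls]; rewrite /run ls.
have linksE T' : T' \in A' -> links (g T) l = links (g T') l.
  move=> A'T'; apply/setP=> u; rewrite !inE; case: (_ =P l) => //= lu.
  by rewrite agree // -lu.
apply: card_unmatched_family; [exact: diagonal_pos_inj | | exact: imset_f].
move=> _ /imsetP[T' A'T' ->]; exists (successor (g T')); rewrite (linksE T') //.
  by apply: matching_successor; exact: gA'.
by rewrite unmatched_successor //; exact: gA'.
Qed.

Lemma card_prefix_maps N : 0 < n -> n * N = #|V| -> #|A| <= n ^ N.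
Proof.
move=> n_gt0 nN; pose m := (\max_(x : V) lev x).+1.
have lev_lt x : lev x < m by rewrite ltnS; exact: leq_bigmax.
apply: (@leq_card_branching _ _ _ new_starts (iota 0 m)) =>
  [T T' AT AT' startsE|T AT].
  apply: g_inj => // x.
  have agree l : l <= m -> forall y, lev y < l -> g T y = g T' y.
    elim: l => // l IHl lm.
    apply: starts_agree; [exact: gP | exact: gP | exact/IHl/ltnW|].
    by apply: startsE; rewrite mem_iota.
  exact: agree (leqnn m) _ (lev_lt x).
apply: leq_trans (branching_runs _ _ AT _) _ => //.
have -> : N = #|starts (g T)|.
  by apply/eqP; rewrite -(eqn_pmul2l n_gt0) nN card_starts //; exact: gP.
apply: leq_trans (prod_run (gP AT) n_gt0).
have -> : iota 0 m = index_iota 0 m by rewrite /index_iota subn0.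
rewrite big_mkord (partition_big (fun s => Ordinal (lev_lt s)) predT) //.
apply/eq_leq/eq_bigr => j _.
by apply: eq_bigl => s; rewrite inE.
Qed.

End Counting.
End PrefixMaps.

(** * The prefix map of a tiling *)

Section Prefixes.
Local Open Scope nat_scope.
Variables (V : finType) (lev : V -> nat) (pos : V -> int) (n : nat).
Local Notation precedes := (precedes lev pos).

Definition chain_tiling (T : {set n.-tuple V}) : Prop :=
  {in T, forall t : n.-tuple V, sorted precedes t} /\
  forall x, #|[set t in T | x \in t]| = 1.

Definition prefix_to (T : {set n.-tuple V}) (x : V) : seq V :=
  if [pick t in T | x \in t] is Some t then take (index x t).+1 t else [::].

Lemma sorted_precedes_uniq (s : seq V) : sorted precedes s -> uniq s.
Proof.
move=> s_sorted; apply: (@sorted_uniq _ (relpre lev ltn)).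
- by move=> y x z /=; exact: ltn_trans.
- by move=> x /=; rewrite ltnn.
by apply: sub_sorted s_sorted => x y /andP[/eqP /= ->].
Qed.

Section OneTiling.
Variable T : {set n.-tuple V}.
Hypothesis TP : chain_tiling T.

Lemma tile_of x : exists2 t, t \in T & x \in t.
Proof.
have /eqP/cards1P[t /setP/(_ t)] := TP.2 x.
by rewrite !inE eqxx => /andP[]; exists t.
Qed.

Lemma tile_unique x t t' : t \in T -> t' \in T -> x \in t -> x \in t' -> t = t'.
Proof.
move=> Tt Tt' xt xt'; have /eqP/cards1P[t0 /setP t0P] := TP.2 x.
have /esym := t0P t; rewrite !inE Tt xt => /eqP ->.
by have /esym := t0P t'; rewrite !inE Tt' xt' => /eqP ->.
Qed.

Lemma prefix_toE x t :
  t \in T -> x \in t -> prefix_to T x = take (index x t).+1 t.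
Proof.
rewrite /prefix_to => Tt xt; case: pickP => [t' /andP[Tt' xt']|/(_ t)].
  by rewrite (tile_unique Tt Tt' xt xt').
by rewrite Tt xt.
Qed.

Lemma prefix_to_nth x0 t i :
  t \in T -> i < n -> prefix_to T (nth x0 t i) = take i.+1 t.
Proof.
move=> Tt lt_in; rewrite (prefix_toE Tt) ?mem_nth ?size_tuple //.
by rewrite index_uniq ?size_tuple //; exact/sorted_precedes_uniq/TP.1.
Qed.

Lemma prefix_map_to : prefix_map lev pos n (prefix_to T).
Proof.
split=> x; have [t Tt xt] := tile_of x.
- by rewrite (prefix_toE Tt xt) size_take_min size_tuple geq_minr.
- have := xt; rewrite -index_mem size_tuple (prefix_toE Tt xt).
  have xE := nth_index x xt; case: (index x t) xE => [|i] xE lt_in.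
    by left; rewrite (take_nth x) ?size_tuple // take0 /= xE.
  right; exists (nth x t i); last first.
    by rewrite prefix_to_nth ?(ltnW lt_in) // (take_nth x) ?size_tuple // xE.
  rewrite -[x in precedes _ x]xE; move/(sortedP x): (TP.1 _ Tt); apply.
  by rewrite size_tuple.
- have ix := xt; rewrite -index_mem size_tuple in ix.
  rewrite (prefix_toE Tt xt) size_takel ?size_tuple // => lt_in.
  exists (nth x t (index x t).+1); split.
    by rewrite prefix_to_nth // [LHS](take_nth x) ?size_tuple.
  move=> y; have [t' Tt' yt'] := tile_of y; rewrite (prefix_toE Tt' yt') => yE.
  have xt' : x \in t'.
    apply: (mem_take (n0 := (index y t').+1)); rewrite yE mem_rcons inE.
    by rewrite (take_nth x) ?size_tuple // mem_rcons inE nth_index // eqxx orbT.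
  have tt' := tile_unique Tt Tt' xt xt'; subst t'.
  have := congr1 size yE; rewrite size_rcons !size_takel ?size_tuple //.
    by case=> iE; rewrite -iE nth_index.
  by move: yt'; rewrite -index_mem size_tuple.
Qed.

End OneTiling.

Lemma prefix_to_sub T T' : 0 < n -> chain_tiling T -> chain_tiling T' ->
  prefix_to T =1 prefix_to T' -> T \subset T'.
Proof.
move=> n_gt0 TP TP' eqp; apply/fintype.subsetP=> t Tt.
have [x0 _] : exists x0 : V, true.
  case: (tval t) (size_tuple t) => [n0|x s _]; last by exists x.
  by move: n_gt0; rewrite -n0.
pose x := nth x0 t n.-1.
have lt_n : n.-1 < n by rewrite prednK.
have pT : prefix_to T x = t.
  by rewrite prefix_to_nth // prednK // take_oversize ?size_tuple.
have [t' Tt' xt'] := tile_of TP' x.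
have := eqp x; rewrite pT (prefix_toE TP' Tt' xt') => tE.
suff -> : t = t' by [].
apply: val_inj; rewrite /= [LHS]tE take_oversize // size_tuple.
have := congr1 size tE; rewrite size_tuple size_take_min size_tuple => {1}->.
exact: geq_minl.
Qed.

Lemma prefix_to_inj T T' : 0 < n -> chain_tiling T -> chain_tiling T' ->
  prefix_to T =1 prefix_to T' -> T = T'.
Proof.
move=> n_gt0 TP TP' eqp; apply/eqP; rewrite finset.eqEsubset.
by rewrite !prefix_to_sub // => x; rewrite eqp.
Qed.

Lemma card_tile_set T : chain_tiling T -> n * #|T| = #|V|.
Proof.
move=> TP; rewrite -sum1_card.
transitivity (\sum_(x : V) \sum_(t in T | x \in t) 1).
  rewrite (exchange_big_dep (mem T)) /= => [|x t _ /andP[]//].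
  rewrite big_distrr /=; apply: eq_bigr => t Tt; rewrite muln1.
  rewrite sum1dep_card -[LHS](size_tuple t).
  have /card_uniqP <- := sorted_precedes_uniq (TP.1 _ Tt).
  by apply: eq_card => x; rewrite inE Tt.
by rewrite -sum1_card; apply: eq_bigr => x _; rewrite sum1dep_card TP.2.
Qed.

End Prefixes.

(** * Ribbon tilings of a region *)

Section Regions.
Local Open Scope nat_scope.
Variables (n : nat) (D : region).

(** Added to [x + y] to make all the levels of the region natural numbers. *)
Definition level_shift : nat := \max_(x : D) `|((val x).1 + (val x).2)%R|.

Definition level (x : D) : nat := `|((val x).1 + (val x).2 + level_shift%:Z)%R|.

Definition abscissa (x : D) : int := (val x).1.

Lemma levelE (x : D) :
  (level x : int) = ((val x).1 + (val x).2 + level_shift%:Z)%R.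
Proof.
rewrite /level gez0_abs //.
have : `|((val x).1 + (val x).2)%R| <= level_shift.
  by rewrite /level_shift (leq_bigmax x).
lia.
Qed.

Lemma level_abscissa_inj (x y : D) :
  level x = level y -> abscissa x = abscissa y -> x = y.
Proof.
move=> lxy; rewrite /abscissa => axy; apply: val_inj.
move: (levelE x) (levelE y); rewrite lxy => -> {lxy}.
by case: (val x) (val y) axy => [a b] [c d] /= -> e; congr pair; lia.
Qed.

Lemma step_precedes (x y : D) :
  step (val x) (val y) -> precedes level abscissa x y.
Proof.
move=> xy; rewrite /precedes /abscissa.
have := levelE x; have := levelE y; case/orP: xy => /eqP -> /= ly lx.
  by rewrite eqxx andbT; apply/eqP; lia.
by rewrite eqxx orbT andbT; apply/eqP; lia.
Qed.

Lemma ribbon_tiling_chain (T : {set n.-tuple D}) :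
  ribbon_tiling T -> chain_tiling level abscissa T.
Proof.
case/andP=> /forall_inP ribT /forallP covT; split=> [t Tt|x]; last exact/eqP.
have /andP[_] := ribT _ Tt; rewrite sorted_map; apply: sub_sorted.
exact: step_precedes.
Qed.

Lemma num_tilings_le (N : nat) :
  0 < n -> n * N = area D -> num_tilings n D <= n ^ N.
Proof.
move=> n_gt0 nN.
apply: (@card_prefix_maps _ level abscissa n level_abscissa_inj
          _ _ (@prefix_to _ n)) => //.
- by move=> T; rewrite inE => /ribbon_tiling_chain; exact: prefix_map_to.
- move=> T T'; rewrite !inE => /ribbon_tiling_chain TP /ribbon_tiling_chain TP'.
  exact: prefix_to_inj TP TP'.
by rewrite nN /area cardfE.
Qed.

Lemma num_tilings_gt0 : 0 < num_tilings n D -> exists N, n * N = area D.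
Proof.
case/card_gt0P=> T; rewrite inE => /ribbon_tiling_chain /card_tile_set TV.
by exists #|T|; rewrite TV /area cardfE.
Qed.

End Regions.

(** * The entropy bound *)

Local Open Scope ring_scope.

Theorem theorem1 (R : realType) (n : nat) (D : region) (hn : (2 <= n)%N)
    (hD : D != fset0) :
  (entropy R n D <= log2 (n%:R : R)%:E)%E.
Proof.
have n_gt0 : (0 < n)%N by exact: ltnW.
have ln2_gt0 : (0 : R) < ln 2 by rewrite ln_gt0 // ltr1n.
have D_gt0 : (0 < area D)%N by rewrite /area cardfs_gt0.
have n_gt0R : (0 : R) < n%:R by rewrite ltr0n.
rewrite /entropy /log2 !inver !gt_eqF ?divr_gt0 ?ltr0n //.
have [T0|T_gt0] := posnP (num_tilings n D).
  rewrite T0 le0_lneNy // !gt0_mulNye ?leNye // lte_fin invr_gt0 //.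
  by rewrite divr_gt0 ?ltr0n.
have [N nN] := num_tilings_gt0 T_gt0.
have N_gt0 : (0 < N)%N by move: D_gt0; rewrite -nN muln_gt0 => /andP[].
have -> : (area D)%:R / n%:R = N%:R :> R.
  by rewrite -nN natrM mulrAC divff ?mul1r // gt_eqF.
rewrite !lne_EFin ?ltr0n // -!EFinM lee_fin mulrAC ler_pM2r ?invr_gt0 //.
rewrite ler_pdivrMr ?ltr0n // mulr_natr -lnXn //.
rewrite ler_ln ?posrE ?exprn_gt0 ?ltr0n //.
by rewrite -natrX ler_nat; exact: num_tilings_le.
Qed.
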